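(* Let $A$ be an RJ-algebra over a field $F$ of characteristic $\neq 2$. Then: (a) $A$ has an element $e$ such that $ae=ea=a$ for every $a\in A^2$; (b) the algebra $A$ has no nonzero nilpotent element with a square root, i.e. if $a\in A^2$ and $a^n=0$ for some integer $n\geq 1$, then $a=0$.
   Context: For a Jordan algebra $A$ over a field $F$ of characteristic $\neq 2$ (not assumed unital), write $A^2=\{a^2: a\in A\}$ (the set of squares, i.e. the elements having a square root in $A$), $U_ab=2(ab)a-a^2b$, $U_a(A)=\{U_ax: x\in A\}$, and for $S\subseteq A$ put ${}^\perp S=\{x\in A: U_ax=0 \text{ for all } a\in S\}$. $A$ is called an RJ-algebra if for every $x\in A$ there exists an idempotent $e\in A$ such that ${}^\perp\{x\}\cap A^2=U_e(A)\cap A^2$. An idempotent is an element $e$ with $e^2=e$ (the zero element is allowed). *)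

(* Defs.v *)
From HB Require Import structures.
From mathcomp Require Import all_boot all_order all_algebra.
From mathcomp Require Import boolp classical_sets.

Set Implicit Arguments.
Unset Strict Implicit.
Unset Printing Implicit Defensive.

Import GRing.Theory.
Local Open Scope ring_scope.
Local Open Scope classical_set_scope.

(* Not necessarily unital. The axioms are those of a linear Jordan algebra and
   are the intended notion only in characteristic <> 2, a hypothesis that is
   left to the results. Right bilinearity follows from commutativity. *)
HB.mixin Record Lmodule_isJordan (F : fieldType) A of GRing.Lmodule F A := {
  jmul : A -> A -> A;
  jmulC : commutative jmul;
  jmulDl : left_distributive jmul +%R;
  jmulZl : forall (k : F) (x y : A), jmul (k *: x) y = k *: jmul x y;
  jordan_identity : forall x y : A,
    jmul (jmul (jmul x x) y) x = jmul (jmul x x) (jmul y x)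
}.

#[short(type="jordanAlgType")]
HB.structure Definition Jordan (F : fieldType) :=
  { A of Lmodule_isJordan F A & GRing.Lmodule F A }.

Declare Scope jordan_scope.
Delimit Scope jordan_scope with J.
Notation "x ∘ y" := (jmul x y) (at level 40, left associativity) : jordan_scope.
Local Open Scope jordan_scope.

Section JordanDefs.
Variables (F : fieldType) (A : jordanAlgType F).
Implicit Types (a b e x : A) (S : set A).

(* [jpow a n] is a^n for n >= 1, with a^(n+1) = a^n a; the value at n = 0 is
   meaningless, since A need not have a unit. *)
Definition jpow a n : A := iter n.-1 (fun y => y ∘ a) a.

Definition squares : set A := [set a ∘ a | a in [set: A]].

Definition U a b : A := ((a ∘ b) ∘ a) *+ 2 - (a ∘ a) ∘ b.

Definition perp S : set A := [set x | forall a, S a -> U a x = 0].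

Definition jidempotent e : Prop := e ∘ e = e.

Definition RJ_algebra : Prop :=
  forall x, exists e, jidempotent e /\
    perp [set x] `&` squares = range (U e) `&` squares.

End JordanDefs.

Arguments squares {F} A.
Arguments RJ_algebra {F} A.

(* Main.v *)
Require Import Defs.
From HB Require Import structures.
From mathcomp Require Import all_boot all_order all_algebra.
From mathcomp Require Import boolp classical_sets.
From mathcomp Require Import ring.

(** (a) For [x = 0] the RJ condition says that every square lies in [U e A] for
    an idempotent [e], and [e] is a unit on [U e A].

    (b) By power associativity it suffices to show that [d^4 = 0] implies
    [d^2 = 0].  Let [e] be the idempotent that RJ attaches to [d].  As
    [U d d^2 = d^4 = 0], the square [c = d^2] lies in [U e A]; also [U d e = 0].
    Comparing Peirce components of [d = d1 + x + d0] with respect to [e] gives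
    [c = x^2] and [c x = c d = 0].  Hence [e + x - c] is an idempotent killed by
    [U d], so it lies in [U e A], which forces [x = 0] and [c = 0]. *)

Set Implicit Arguments.
Unset Strict Implicit.
Unset Printing Implicit Defensive.

Import GRing.Theory.
Local Open Scope ring_scope.
Local Open Scope jordan_scope.

(** * Reflexive decision of linear identities in a module *)

Section LinearTerms.
Variables (F : fieldType) (V : lmodType F).

Inductive lterm :=
  | LZero
  | LAtom of nat
  | LAdd of lterm & lterm
  | LOpp of lterm
  | LMuln of lterm & nat
  | LScale of F & lterm.

Fixpoint leval (env : seq V) t : V :=
  match t with
  | LZero => 0
  | LAtom i => nth 0 env i
  | LAdd s t => leval env s + leval env t
  | LOpp t => - leval env t
  | LMuln t n => leval env t *+ n
  | LScale k t => k *: leval env t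
  end.

Fixpoint lcoef t (i : nat) : F :=
  match t with
  | LZero => 0
  | LAtom j => if eqn j i then 1 else 0
  | LAdd s t => lcoef s i + lcoef t i
  | LOpp t => - lcoef t i
  | LMuln t n => n%:R * lcoef t i
  | LScale k t => k * lcoef t i
  end.

Lemma leval_sum env t :
  leval env t = \sum_(i < size env) lcoef t i *: nth 0 env i.
Proof.
elim: t => [|j|s IHs t IHt|t IHt|t IHt n|k t IHt] /=.
- by rewrite big1 // => i _; rewrite scale0r.
(* An index past the end of [env] reads the default [0], and its coefficient occurs nowhere in the
   sum. *)
- have [lt_j|le_j] := ltnP j (size env); last first.
    rewrite nth_default // big1 // => i _.
    case: eqnP => [eq_ji|_]; last by rewrite scale0r.
    by move: (ltn_ord i); rewrite -eq_ji ltnNge le_j.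
  rewrite (bigD1 (Ordinal lt_j)) //=; case: eqnP => // _.
  rewrite scale1r big1 ?addr0 // => i ne_i.
  case: eqnP => [eq_ji|_]; last by rewrite scale0r.
  by case/eqP: ne_i; apply: val_inj.
- by rewrite IHs IHt -big_split; apply: eq_bigr => i _; rewrite scalerDl.
- by rewrite IHt -sumrN; apply: eq_bigr => i _; rewrite scaleNr.
- rewrite IHt -sumrMnl; apply: eq_bigr => i _.
  by rewrite mulr_natl scalerMnl.
- by rewrite IHt scaler_sumr; apply: eq_bigr => i _; rewrite scalerA.
Qed.

(** A recursive conjunction, so that for a concrete environment it computes to finitely many scalar
    goals for [field]. *)
Fixpoint same_lcoef s t n : Prop :=
  if n is m.+1 then lcoef s m = lcoef t m /\ same_lcoef s t m else True.

Lemma leval_eq env s t :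
  same_lcoef s t (size env) -> leval env s = leval env t.
Proof.
move=> eq_st; rewrite !leval_sum; apply: eq_bigr => i _; congr (_ *: _).
case: i => i /=; elim: (size env) eq_st => //= n IHn [eq_n /IHn eq_lt].
by rewrite ltnS leq_eqVlt => /orP[/eqP ->|/eq_lt].
Qed.

End LinearTerms.

Ltac lmod_index x env :=
  lazymatch env with
  | cons x _ => constr:(0%N)
  | cons _ ?env' => let n := lmod_index x env' in constr:(S n)
  end.

Ltac lmod_env env t :=
  lazymatch t with
  | GRing.zero => env
  | GRing.add ?a ?b => let env' := lmod_env env a in lmod_env env' b
  | GRing.opp ?a => lmod_env env a
  | GRing.natmul ?a _ => lmod_env env a
  | GRing.scale _ ?a => lmod_env env a
  (* [lmod_index] fails on an atom not yet listed; the match then falls through to the branch that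
     adds it. *)
  | ?x => match env with
          | _ => let n := lmod_index x env in env
          | _ => constr:(cons x env)
          end
  end.

Ltac lmod_reify F env t :=
  lazymatch t with
  | GRing.zero => constr:(@LZero F)
  | GRing.add ?a ?b => let s := lmod_reify F env a in
                       let t := lmod_reify F env b in constr:(LAdd s t)
  | GRing.opp ?a => let s := lmod_reify F env a in constr:(LOpp s)
  | GRing.natmul ?a ?n => let s := lmod_reify F env a in constr:(LMuln s n)
  | GRing.scale ?k ?a => let s := lmod_reify F env a in
                         constr:(@LScale F k s)
  | ?x => let n := lmod_index x env in constr:(@LAtom F n)
  end.

Ltac lmod F A :=
  lazymatch goal with
  | |- ?l = ?r =>
    let env := lmod_env (@nil A) l in
    let env := lmod_env env r in
    let s := lmod_reify F env l in
    let t := lmod_reify F env r in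
    apply: (@leval_eq F A env s t);
    cbn [same_lcoef lcoef size eqn]; repeat split; try by field
  end.

(** Derives an equation from a vanishing linear combination [w] of known ones; [lmod] checks the
    first premise. *)
Lemma eq_from_sub (V : zmodType) (w u v : V) : u - v = w -> w = 0 -> u = v.
Proof. by move=> <- /subr0_eq. Qed.

Lemma lincomb_eq0 (F : fieldType) (V : lmodType F) (k l : F)
    (u1 v1 u2 v2 : V) :
  u1 = v1 -> u2 = v2 -> k *: (u1 - v1) + l *: (u2 - v2) = 0.
Proof. by move=> -> ->; rewrite !subrr !scaler0 addr0. Qed.

(** * Jordan algebras *)

Section JordanTheory.
Variables (F : fieldType) (A : jordanAlgType F).
Hypothesis F2 : (2%:R : F) != 0.
Implicit Types (a b c d e x y z w : A).

Lemma jmulDr x y z : x ∘ (y + z) = x ∘ y + x ∘ z.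
Proof. by rewrite jmulC jmulDl !(jmulC x). Qed.

Lemma jmulZr k x y : x ∘ (k *: y) = k *: (x ∘ y).
Proof. by rewrite jmulC jmulZl (jmulC x). Qed.

Lemma jmulNl x y : (- x) ∘ y = - (x ∘ y).
Proof. by rewrite -scaleN1r jmulZl scaleN1r. Qed.

Lemma jmulNr x y : x ∘ (- y) = - (x ∘ y).
Proof. by rewrite jmulC jmulNl jmulC. Qed.

Lemma jmul0r x : x ∘ 0 = 0.
Proof. by rewrite -(scale0r x) jmulZr !scale0r. Qed.

Lemma jmul0l x : 0 ∘ x = 0.
Proof. by rewrite jmulC jmul0r. Qed.

Lemma jmulMnr x y n : x ∘ (y *+ n) = (x ∘ y) *+ n.
Proof. by rewrite -!scaler_nat jmulZr. Qed.

Definition jmulE :=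
  (@jmulDl F A, jmulDr, jmulNl, jmulNr, @jmulZl F A, jmulZr, jmul0r, jmul0l, jmulMnr).

(* The substitutions x + z and x - z isolate the part linear in z without
   dividing by 3. *)
Lemma jordan_linearized x y z :
  (((x ∘ z) ∘ y) ∘ x) *+ 2 + ((x ∘ x) ∘ y) ∘ z
  = ((x ∘ z) ∘ (y ∘ x)) *+ 2 + (x ∘ x) ∘ (y ∘ z).
Proof.
pose D x := ((x ∘ x) ∘ y) ∘ x - (x ∘ x) ∘ (y ∘ x).
have D0 v : D v = 0 by rewrite /D jordan_identity subrr.
apply: (@eq_from_sub _ (2%:R^-1 *: (D (x + z) - D (x - z)) - D z)).
  by rewrite /D !jmulE (jmulC z x); lmod F A.
by rewrite !D0 !subr0 scaler0.
Qed.

Lemma jordan_multilinear x y z w :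
  ((x ∘ z) ∘ y) ∘ w + ((z ∘ w) ∘ y) ∘ x + ((w ∘ x) ∘ y) ∘ z
  = (x ∘ z) ∘ (y ∘ w) + (z ∘ w) ∘ (y ∘ x) + (w ∘ x) ∘ (y ∘ z).
Proof.
pose K x := ((((x ∘ z) ∘ y) ∘ x) *+ 2 + ((x ∘ x) ∘ y) ∘ z)
  - (((x ∘ z) ∘ (y ∘ x)) *+ 2 + (x ∘ x) ∘ (y ∘ z)).
have K0 v : K v = 0 by rewrite /K jordan_linearized subrr.
(* [K] is quadratic in its argument, so its polarization yields each term of the claim twice. *)
apply: (@eq_from_sub _ (2%:R^-1 *: (K (x + w) - K x - K w))).
  by rewrite /K !jmulE (jmulC z w) (jmulC x w); lmod F A.
by rewrite !K0 !subr0 scaler0.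
Qed.

(** Write [L_y] for multiplication by [y]. The multilinear identity expresses [L_(a^(k+3))] through
    [L_a] and the multiplications by [a^2], [a^(k+1)] and [a^(k+2)]. Induction on two consecutive
    powers then works, as the Jordan identity says that [L_(a^2)] commutes with [L_a]. *)
Lemma jpow_commute a k w :
  jpow a k.+1 ∘ (a ∘ w) = a ∘ (jpow a k.+1 ∘ w).
Proof.
suff [] : (forall w, jpow a k.+1 ∘ (a ∘ w) = a ∘ (jpow a k.+1 ∘ w)) /\
          (forall w, jpow a k.+2 ∘ (a ∘ w) = a ∘ (jpow a k.+2 ∘ w)) by [].
have sq_comm v : (a ∘ a) ∘ (a ∘ v) = a ∘ ((a ∘ a) ∘ v).
  by rewrite (jmulC a v) -jordan_identity jmulC.
elim: k {w} => [|k [IHk IHk1]]; first by split.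
split=> // w.
have expand v : jpow a k.+3 ∘ v = (jpow a k.+2 ∘ (a ∘ v)) *+ 2
    + (a ∘ a) ∘ (jpow a k.+1 ∘ v) - jpow a k.+1 ∘ (a ∘ (a ∘ v))
    - a ∘ (a ∘ (jpow a k.+1 ∘ v)).
  have /eqP := jordan_multilinear (jpow a k.+1) a a v.
  rewrite -subr_eq0 => /eqP J.
  apply: (eq_from_sub _ J).
  rewrite -[jpow a k.+3]/((jpow a k.+1 ∘ a) ∘ a).
  rewrite -[jpow a k.+2]/(jpow a k.+1 ∘ a).
  rewrite (jmulC v (jpow _ _)) (jmulC (jpow _ _ ∘ v) (a ∘ a)).
  rewrite (jmulC (a ∘ v) (a ∘ jpow _ _)) (jmulC a (jpow _ _)).
  rewrite (jmulC (jpow _ _ ∘ v) a) (jmulC (a ∘ _) a).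
  rewrite (jmulC (a ∘ (a ∘ v)) (jpow _ _)) (jmulC (a ∘ (jpow _ _ ∘ v)) a).
  by lmod F A.
by rewrite !expand !jmulE !(IHk, IHk1, sq_comm).
Qed.

Lemma jpowD a m n : jpow a m.+1 ∘ jpow a n.+1 = jpow a (m + n).+2.
Proof.
elim: n => [|n IHn]; first by rewrite addn0.
rewrite -[jpow a n.+2]/(jpow a n.+1 ∘ a).
by rewrite (jmulC _ a) jpow_commute IHn addnS jmulC.
Qed.

Lemma jpow_ge a n m : (0 < n <= m)%N -> jpow a n = 0 -> jpow a m = 0.
Proof.
case: n => // n /= /subnKC <- a_n0.
elim: (m - n.+1)%N => [|k IHk]; first by rewrite addn0.
by rewrite addnS -[LHS]/(jpow a (n.+1 + k) ∘ a) IHk jmul0l.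
Qed.

Lemma iter_square a k : iter k (fun v => v ∘ v) a = jpow a (2 ^ k).
Proof.
elim: k => //= k ->; have := expn_gt0 2 k.
by rewrite expnS mul2n -addnn; case: (2 ^ k)%N => // m _; rewrite jpowD addnS.
Qed.

(** * Peirce decomposition with respect to an idempotent *)

Section Peirce.
Variable e : A.
Hypothesis ee : e ∘ e = e.

(** This is [L_e (L_e - 1) (2 L_e - 1) = 0]: the possible eigenvalues are 0, 1 and 1/2. *)
Lemma idempotent_cubic z :
  (e ∘ (e ∘ (e ∘ z))) *+ 2 = (e ∘ (e ∘ z)) *+ 3 - e ∘ z.
Proof.
have /eqP := jordan_linearized e e z; rewrite !ee.
rewrite -subr_eq0 !(jmulC _ e) => /eqP J.
by apply: (eq_from_sub _ J); lmod F A.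
Qed.

Lemma idempotent_mulU z : e ∘ U e z = U e z.
Proof.
rewrite /U ee !jmulE !(jmulC (e ∘ z)) idempotent_cubic; lmod F A.
Qed.

Lemma idempotent_rangeU z : range (U e) z <-> e ∘ z = z.
Proof.
split=> [[y _ <-]|ez]; first exact: idempotent_mulU.
by exists z => //; rewrite /U ee ez jmulC ez; lmod F A.
Qed.

(** The linearized identity reads [(2j - 1) (e (y z) - i (y z)) = 0]. *)
Lemma peirce_mul i j y z : e ∘ y = i *: y -> e ∘ z = j *: z ->
  j *+ 2 != 1 -> e ∘ (y ∘ z) = i *: (y ∘ z).
Proof.
move=> ey ez; rewrite -subr_eq0 => j_half.
have /eqP := jordan_linearized e y z.
rewrite -subr_eq0 ee ey ez (jmulC y e) ey !jmulE (jmulC z y).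
rewrite (jmulC _ e) => /eqP J.
apply/eqP; rewrite -subr_eq0 -(inj_eq (scalerI j_half)) scaler0 -J.
by apply/eqP; lmod F A.
Qed.

(** Says that [x ∘ x] has no component of eigenvalue 1/2. *)
Lemma peirce_half_square x : e ∘ x = 2%:R^-1 *: x ->
  e ∘ (e ∘ (x ∘ x)) = e ∘ (x ∘ x).
Proof.
move=> ex; have /eqP := jordan_linearized x e e.
rewrite -subr_eq0 ee (jmulC x e) ex !jmulE (jmulC x e) ex !jmulE.
rewrite !(jmulC _ e) => /eqP J.
by apply: (eq_from_sub _ J); lmod F A.
Qed.

Lemma peirce_decomposition d : exists d1 x d0,
  [/\ d = d1 + x + d0, e ∘ d1 = d1, e ∘ x = 2%:R^-1 *: x & e ∘ d0 = 0].
Proof.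
(* The Lagrange interpolation polynomials in [L_e] at the nodes 1, 1/2, 0, applied to [d]. *)
exists (U e d), ((e ∘ d - e ∘ (e ∘ d)) *+ 4),
  (d - (e ∘ d) *+ 3 + (e ∘ (e ∘ d)) *+ 2).
have cubic := idempotent_cubic d.
split; first by rewrite /U ee (jmulC (e ∘ d)); lmod F A.
- exact: idempotent_mulU.
- rewrite !jmulE; apply: (eq_from_sub _ (lincomb_eq0 (-2%:R) 0 cubic cubic)).
  by lmod F A.
- by rewrite !jmulE cubic; lmod F A.
Qed.

End Peirce.

(** * Consequences of the RJ condition *)

Lemma RJ_square_zero d : RJ_algebra A ->
  (d ∘ d) ∘ (d ∘ d) = 0 -> d ∘ d = 0.
Proof.
move=> RJ_A; set c := d ∘ d => cc.
have [e [ee perp_d]] := RJ_A d.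
(* The RJ condition as a test on squares, applied below to [c] and to the idempotents [e] and [f],
   which are their own squares. *)
have in_perp s : squares A s -> U d s = 0 <-> e ∘ s = s.
  move=> sq_s; rewrite -(idempotent_rangeU ee).
  split=> [Us|range_s].
    suff: (range (U e) `&` squares A)%classic s by case.
    by rewrite -perp_d; split=> // a ->.
  have [] : (perp [set d] `&` squares A)%classic s by rewrite perp_d.
  by move/(_ d erefl).
have Udc : U d c = 0.
  by rewrite /U cc subr0 (jmulC d c) jordan_identity cc mul0rn.
have ec : e ∘ c = c by apply/in_perp => //; exists d.
have Ude : U d e = 0 by apply/in_perp => //; exists e.
have [d1 [x [d0 [def_d e1 ex e0]]]] := peirce_decomposition ee d.
have one_nhalf : (1 : F) *+ 2 != 1 by rewrite -subr_eq0 mulr2n addrK oner_eq0.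
have zero_nhalf : (0 : F) *+ 2 != 1 by rewrite mul0rn eq_sym oner_eq0.
have e1' : e ∘ d1 = 1 *: d1 by rewrite scale1r.
have e0' : e ∘ d0 = 0 *: d0 by rewrite scale0r.
have ed11 : e ∘ (d1 ∘ d1) = d1 ∘ d1.
  by rewrite (peirce_mul ee e1' e1') // scale1r.
have ed00 : e ∘ (d0 ∘ d0) = 0.
  by rewrite (peirce_mul ee e0' e0') // scale0r.
(* The product [z ∘ d0] has both eigenvalues 1 and 0. *)
have ann z : e ∘ z = z -> z ∘ d0 = 0.
  move=> ez; have ez' : e ∘ z = 1 *: z by rewrite scale1r.
  rewrite -[LHS]scale1r -(peirce_mul ee ez' e0') // (jmulC z).
  by rewrite (peirce_mul ee e0' ez') // scale0r.
have ed1x : e ∘ (x ∘ d1) = 2%:R^-1 *: (x ∘ d1) by apply: peirce_mul e1' _.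
have ed0x : e ∘ (x ∘ d0) = 2%:R^-1 *: (x ∘ d0) by apply: peirce_mul e0' _.
have exx := peirce_half_square ee ex.
have xd1C := jmulC d1 x; have xd0C := jmulC d0 x.
have d1d0 : d1 ∘ d0 = 0 by apply: ann.
have d0d1 : d0 ∘ d1 = 0 by rewrite jmulC.
have def_c : c = d1 ∘ d1 + (x ∘ d1) *+ 2 + (x ∘ d0) *+ 2 + x ∘ x + d0 ∘ d0.
  by rewrite /c def_d !jmulE xd1C xd0C d1d0 d0d1; lmod F A.
have ed : e ∘ d = d1 + 2%:R^-1 *: x by rewrite def_d !jmulE e1 ex e0 addr0.
have eqU : d1 ∘ d1 + x ∘ d1 - x ∘ d0 - d0 ∘ d0 = 0.
  rewrite -Ude /U -/c (jmulC c) ec (jmulC d) ed def_c def_d !jmulE.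
  by rewrite xd1C d1d0; lmod F A.
(* Applying [e] once and twice scales the 1/2-component by 1/2 and 1/4 and fixes the 1-component,
   which separates the two. *)
have eeqU := congr1 (jmul e) eqU; have eeeqU := congr1 (jmul e) eeqU.
rewrite !jmulE ed11 ed1x ed0x ed00 in eeqU eeeqU.
rewrite !jmulE ed11 ed1x ed0x in eeeqU.
have d1d1 : d1 ∘ d1 = 0.
  apply: (eq_from_sub _ (lincomb_eq0 2%:R (-1) eeeqU eeqU)).
  by lmod F A.
have eq_half : x ∘ d1 = x ∘ d0.
  apply: (eq_from_sub _ (lincomb_eq0 4%:R (-4%:R) eeqU eeeqU)).
  by lmod F A.
have d0d0 : d0 ∘ d0 = 0.
  move: eqU; rewrite d1d1 eq_half add0r subrr sub0r => /eqP.
  by rewrite oppr_eq0 => /eqP.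
rewrite d1d1 d0d0 eq_half add0r addr0 in def_c.
(* Now [c] is [x ∘ x] plus four times [x ∘ d0]; as [e ∘ c = c], its 1/2-component must vanish. *)
have ec1 := ec; rewrite def_c !jmulE ed0x in ec1.
have ec2 := congr1 (jmul e) ec1; rewrite !jmulE ed0x exx in ec2.
have xd0 : x ∘ d0 = 0.
  apply: (eq_from_sub _ (lincomb_eq0 (-1) 0 ec2 ec2)).
  by lmod F A.
have xd1 : x ∘ d1 = 0 by rewrite eq_half.
have c_xx : c = x ∘ x by rewrite def_c xd0 mul0rn !add0r.
have xc : x ∘ c = 0.
  (* It becomes [c x = (1/2) c x]; the multilinear identity gives the same for [d1] next. *)
  have := jordan_identity x e.
  rewrite -c_xx (jmulC c e) ec ex !jmulE (jmulC c) => J.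
  apply: (eq_from_sub _ (lincomb_eq0 2%:R 0 J J)).
  by lmod F A.
have d1c : d1 ∘ c = 0.
  have := jordan_multilinear x x e d1.
  rewrite (jmulC x e) ex e1 !jmulE (jmulC d1 x) xd1 -c_xx !jmulE (jmulC c) => J.
  apply: (eq_from_sub _ (lincomb_eq0 (-2%:R) 0 J J)).
  by lmod F A.
have dc : d ∘ c = 0.
  by rewrite def_d !jmulE d1c xc (jmulC d0) ann // !addr0.
have Udx : U d x = 0.
  have dx : d ∘ x = c.
    by rewrite def_d !jmulE xd1C xd0C xd1 xd0 -c_xx add0r addr0.
  by rewrite /U -/c (jmulC c) xc dx jmulC dc mul0rn subr0.
(* The square of [e + x] is [e + x + c]; as [e ∘ c = c] and [c] annihilates [x] and itself,
   subtracting [c] makes it idempotent. *)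
pose f := e + x - c.
have ff : f ∘ f = f.
  rewrite /f !jmulE ee ec ex (jmulC x e) ex xc (jmulC c e) ec (jmulC c x) xc cc.
  by rewrite -c_xx; lmod F A.
have Udf : U d f = 0.
  transitivity (U d e + U d x - U d c); first by rewrite /U !jmulE; lmod F A.
  by rewrite Ude Udx Udc addr0 subr0.
have : e ∘ f = f by apply/in_perp => //; exists f.
rewrite /f !jmulE ee ex ec => J.
have x0 : x = 0.
  by apply: (eq_from_sub _ (lincomb_eq0 (-2%:R) 0 J J)); lmod F A.
by rewrite c_xx x0 jmul0l.
Qed.

Lemma RJ_square_nilpotent b k : RJ_algebra A ->
  iter k.+1 (fun v => v ∘ v) b = 0 -> b ∘ b = 0.
Proof. by move=> RJ_A; elim: k => //= k IHk /(RJ_square_zero RJ_A). Qed.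

Lemma RJ_squares_unit : RJ_algebra A ->
  exists e, forall a, squares A a -> a ∘ e = a /\ e ∘ a = a.
Proof.
move=> RJ_A; have [e [ee perp0]] := RJ_A 0; exists e => a sq_a.
suff ea : e ∘ a = a by rewrite jmulC.
apply/(idempotent_rangeU ee).
suff: (range (U e) `&` squares A)%classic a by case.
by rewrite -perp0; split=> // _ ->; rewrite /U !jmulE mul0rn subr0.
Qed.

End JordanTheory.

Theorem lemma1p3 (F : fieldType) (charF : 2%N \notin [pchar F])
    (A : jordanAlgType F) (RJ_A : RJ_algebra A) :
  (exists e : A, forall a : A, squares A a -> a ∘ e = a /\ e ∘ a = a) /\
  (forall (a : A) (n : nat),
      squares A a -> (1 <= n)%N -> jpow a n = 0 -> a = 0).
Proof.
have F2 : (2%:R : F) != 0 by move: charF; rewrite inE /=.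
split; first exact: RJ_squares_unit.
move=> _ n [b _ <-] n_gt0 a_n0; apply: (@RJ_square_nilpotent _ _ F2 b n) => //.
(* Squaring [b] repeatedly [n + 1] times gives the power [2 ^ n] of [b ∘ b], and [n < 2 ^ n]. *)
rewrite iterSr iter_square //; apply: jpow_ge a_n0.
by rewrite n_gt0 ltnW // ltn_expl.
Qed.
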